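(* Let $(\mathcal{N},\mathcal{I})$ be a $k$-system with rank $r$ on a ground set of size $n$, let $f:2^{\mathcal{N}}\to\mathbb{R}_{\ge0}$ be non-negative submodular, and run SimultaneousGreedys with $\ell=\lfloor 2+\sqrt{k+2}\rfloor$ solutions. Then the algorithm makes $O(krn)$ calls to the value and independence oracles and outputs an independent set whose approximation ratio is at most $(1+\sqrt{k+2})^2=k+O(\sqrt{k})$. Moreover, when $f$ is non-negative monotone submodular and $\ell=1$, the approximation ratio improves to $k+1$.
   Context: $\mathcal{N}$ is a finite ground set of size $n$. A set function $f$ is submodular if $f(X\cup Y)+f(X\cap Y)\le f(X)+f(Y)$ for all $X,Y\subseteq\mathcal{N}$, and monotone if $f(A)\le f(B)$ for $A\subseteq B$; write $f(u\mid S)=f(S\cup\{u\})-f(S)$ and $S+u=S\cup\{u\}$. An independence system $(\mathcal{N},\mathcal{I})$ is a non-empty family $\mathcal{I}\subseteq 2^{\mathcal{N}}$ closed under taking subsets. For $B\subseteq\mathcal{N}$, a base of $B$ is an inclusion-maximal independent subset of $B$. The system is a $k$-system if for every $B\subseteq\mathcal{N}$ the ratio between the sizes of any two bases of $B$ is at most $k$. The rank $r$ is the maximum size of an independent set. It is assumed that $\{u\}\in\mathcal{I}$ for every $u\in\mathcal{N}$. $OPT$ denotes a set in $\mathcal{I}$ maximizing $f$; an output $S\in\mathcal{I}$ has approximation ratio at most $\alpha$ if $f(S)\ge f(OPT)/\alpha$. The algorithm accesses $f$ only via a value oracle and $\mathcal{I}$ only via an independence oracle. SimultaneousGreedys$(\mathcal{N},f,\mathcal{I},\ell)$: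 initialize $S^{(j)}_0=\varnothing$ for $j=1,\dots,\ell$ and $\mathcal{N}_0=\mathcal{N}$. At iteration $i=1,2,\dots$, let $\mathcal{A}_i$ be the set of pairs $(u,j)$ with $u\in\mathcal{N}_{i-1}$, $j\in\{1,\dots,\ell\}$, $S^{(j)}_{i-1}+u\in\mathcal{I}$ and $f(u\mid S^{(j)}_{i-1})>0$. If $\mathcal{A}_i=\varnothing$, stop. Otherwise choose $(u_i,j_i)\in\mathcal{A}_i$ maximizing $f(u\mid S^{(j)}_{i-1})$, set $S^{(j_i)}_i=S^{(j_i)}_{i-1}+u_i$, $S^{(j)}_i=S^{(j)}_{i-1}$ for $j\ne j_i$, and $\mathcal{N}_i=\mathcal{N}_{i-1}-u_i$. On termination, output the set maximizing $f$ among the $\ell$ final solutions. *)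

(* Defs.v *)
From mathcomp Require Import all_boot all_order all_algebra.
From mathcomp Require Import reals.

Set Implicit Arguments.
Unset Strict Implicit.
Unset Printing Implicit Defensive.

Import Order.TTheory GRing.Theory Num.Theory.
Local Open Scope ring_scope.

Section SetFunctions.
Variables (R : realType) (T : finType).
Implicit Types (f : {set T} -> R) (I : {set {set T}}).

Definition nonnegative f := forall X, 0 <= f X.

Definition submodular f :=
  forall X Y, f (X :|: Y) + f (X :&: Y) <= f X + f Y.

Definition monotone f := forall A B : {set T}, A \subset B -> f A <= f B.

Definition independence_system I :=
  I != set0 /\ forall A B : {set T}, A \subset B -> B \in I -> A \in I.

Definition base I (B X : {set T}) : bool :=
  maxset (fun Y : {set T} => (Y \in I) && (Y \subset B)) X.

(* The ratio condition #|X| / #|Y| <= k is written without division, so that  *)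
(* sets B whose only base is empty satisfy it.                                *)
Definition k_system (k : R) I :=
  independence_system I /\
  forall B X Y : {set T}, base I B X -> base I B Y -> #|X|%:R <= k * #|Y|%:R.

Definition rank I : nat := (\max_(X in I) #|X|)%N.

Definition optimal f I (O : {set T}) :=
  O \in I /\ forall X, X \in I -> f X <= f O.

Definition approx_ratio_le f I (alpha : R) (S : {set T}) :=
  forall OPT, optimal f I OPT -> f OPT / alpha <= f S.

End SetFunctions.

(* Computations that access the set function and the independence system only *)
(* through queries. [Choose p q] continues as p or as q, arbitrarily; it is   *)
(* used to leave all tie-breaking unspecified.                                *)
Inductive oprog (T : finType) (R X : Type) : Type :=
| Ret of X
| AskValue of {set T} & (R -> oprog T R X)
| AskIndep of {set T} & (bool -> oprog T R X)
| Choose of oprog T R X & oprog T R X.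

Arguments Ret {T R X}.
Arguments AskValue {T R X}.
Arguments AskIndep {T R X}.
Arguments Choose {T R X}.

Fixpoint bind T R X Y (p : oprog T R X) (q : X -> oprog T R Y) : oprog T R Y :=
  match p with
  | Ret x => q x
  | AskValue B p' => AskValue B (fun v => bind (p' v) q)
  | AskIndep B p' => AskIndep B (fun b => bind (p' b) q)
  | Choose p1 p2 => Choose (bind p1 q) (bind p2 q)
  end.

(* [exec f I p x c]: some run of p, with queries answered according to f and  *)
(* I, returns x after exactly c oracle calls (value and independence calls    *)
(* together).                                                                 *)
Inductive exec (T : finType) R X (f : {set T} -> R) (I : {set {set T}}) :
    oprog T R X -> X -> nat -> Prop :=
| exec_ret x : exec f I (Ret x) x 0
| exec_value S p x c :
    exec f I (p (f S)) x c -> exec f I (AskValue S p) x c.+1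
| exec_indep S p x c :
    exec f I (p (S \in I)) x c -> exec f I (AskIndep S p) x c.+1
| exec_left p q x c : exec f I p x c -> exec f I (Choose p q) x c
| exec_right p q x c : exec f I q x c -> exec f I (Choose p q) x c.

Lemma exec_total (T : finType) R X (f : {set T} -> R) I (p : oprog T R X) :
  exists x c, exec f I p x c.
Proof.
elim: p => [x|S p IH|S p IH|p [x [c H]] q _].
- by exists x, 0%N; apply: exec_ret.
- by have [x [c H]] := IH (f S); exists x, c.+1; apply: exec_value.
- by have [x [c H]] := IH (S \in I); exists x, c.+1; apply: exec_indep.
- by exists x, c; apply: exec_left.
Qed.

Section SimultaneousGreedys.
Variables (T : finType) (R : realType) (l : nat).

(* An arbitrary element of y :: s. *)
Fixpoint pick_any X (y : X) (s : seq X) : oprog T R X :=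
  if s is z :: s' then Choose (Ret y) (pick_any z s') else Ret y.

Definition maximizers X (s : seq (X * R)) : seq X :=
  [seq p.1 | p <- s & all (fun q => q.2 <= p.2) s].

Definition ask_marginal (u : T) (S : {set T}) : oprog T R R :=
  AskValue (u |: S) (fun a => AskValue S (fun b => Ret (a - b))).

(* The pairs (u, j) of s that belong to A_i, each with its gain f(u | S_j). *)
Fixpoint admissible (S : 'I_l -> {set T}) (s : seq (T * 'I_l)) :
    oprog T R (seq (T * 'I_l * R)) :=
  if s is (u, j) :: s' then
    AskIndep (u |: S j) (fun indep =>
      if indep then
        bind (ask_marginal u (S j)) (fun g =>
        bind (admissible S s') (fun A =>
        Ret (if 0 < g then ((u, j), g) :: A else A)))
      else admissible S s')
  else Ret [::].

(* The number m bounds #|N|: when it reaches 0 no element is left, hence no   *)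
(* pair is admissible, and the loop stops as it should.                       *)
Fixpoint greedy_loop (m : nat) (N : {set T}) (S : 'I_l -> {set T}) :
    oprog T R ('I_l -> {set T}) :=
  if m is m'.+1 then
    bind (admissible S [seq (u, j) | u <- enum N, j <- enum 'I_l]) (fun A =>
    if maximizers A is y :: s then
      bind (pick_any y s) (fun uj =>
      greedy_loop m' (N :\ uj.1)
        (fun j => if j == uj.2 then uj.1 |: S j else S j))
    else Ret S)
  else Ret S.

Fixpoint ask_values (S : 'I_l -> {set T}) (s : seq 'I_l) :
    oprog T R (seq ('I_l * R)) :=
  if s is j :: s' then
    AskValue (S j) (fun v =>
    bind (ask_values S s') (fun V => Ret ((j, v) :: V)))
  else Ret [::].

(* The last branch is reached only for l = 0. *)
Definition simultaneous_greedys : oprog T R {set T} :=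
  bind (greedy_loop #|T| [set: T] (fun=> set0)) (fun S =>
  bind (ask_values S (enum 'I_l)) (fun V =>
  if maximizers V is j :: s then bind (pick_any j s) (fun j' => Ret (S j'))
  else Ret set0)).

End SimultaneousGreedys.

(* Main.v *)
Require Import Defs.
From mathcomp Require Import all_boot all_order all_algebra.
From mathcomp Require Import reals.
From mathcomp Require Import lra ring zify.

(** Let S_1, ..., S_l be the final solutions, S the output and O an optimum.
    An element of O missing from S_j either was blocked by S_j while still
    available, or went to another solution where its gain was at least as
    large, or has nonpositive marginal at S_j. Since S_j is a base of S_j
    together with what it blocks, the first m elements of S_j block at most
    k m elements of O; the greedy gains decrease, so by Abel summation the
    blocked elements cost at most k (f(S_j) - f(0)). The elements taken by the
    other solutions cost at most the sum of the f(S_i) over i <> j. Hence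
    f(O u S_j) <= (k + l) f(S) for every j, which suffices when f is monotone
    and l = 1. In general the S_j are disjoint, so the values f(O u S_j) add
    up to at least (l - 1) f(O), and (l - 1) f(O) <= l (k + l) f(S).

    The loop adds one element per iteration and makes at most 3 n l calls in
    it, so there are at most (l r + 1) 3 n l + l calls, where l ^ 2 = O(k). *)

Set Implicit Arguments.
Unset Strict Implicit.
Unset Printing Implicit Defensive.

Import Order.TTheory GRing.Theory Num.Theory.
Local Open Scope ring_scope.

(** * Runs of oracle programs: call counts and greedy choices *)

Section OracleComputations.
Variables (T : finType) (R : realType) (f : {set T} -> R) (I : {set {set T}}).

Lemma exec_retE X (x y : X) c : exec f I (Ret x) y c -> y = x /\ c = 0%N.
Proof. by move=> H; inversion H. Qed.

Lemma exec_bindE X Y (p : oprog T R X) (q : X -> oprog T R Y) y c :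
  exec f I (bind p q) y c ->
  exists x c1 c2, [/\ exec f I p x c1, exec f I (q x) y c2 & c = (c1 + c2)%N].
Proof.
elim: p c => [x|S p IH|S p IH|p IHp p' IHp'] c /= H.
- by exists x, 0%N, c; split=> //; apply: exec_ret.
- inversion H as [|? ? ? c' H'| | |]; subst.
  have [x [c1 [c2 [H1 H2 ->]]]] := IH _ _ H'.
  by exists x, c1.+1, c2; split=> //; apply: exec_value.
- inversion H as [| |? ? ? c' H'| |]; subst.
  have [x [c1 [c2 [H1 H2 ->]]]] := IH _ _ H'.
  by exists x, c1.+1, c2; split=> //; apply: exec_indep.
- inversion H as [| | |? ? ? ? H'|? ? ? ? H']; subst.
  + have [x [c1 [c2 [H1 H2 ->]]]] := IHp _ H'.
    by exists x, c1, c2; split=> //; apply: exec_left.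
  + have [x [c1 [c2 [H1 H2 ->]]]] := IHp' _ H'.
    by exists x, c1, c2; split=> //; apply: exec_right.
Qed.

Lemma exec_pick_any (X : eqType) (y : X) s x c :
  exec f I (pick_any T R y s) x c -> x \in y :: s /\ c = 0%N.
Proof.
elim: s y => [|z s IH] y /= H.
  by have [-> ->] := exec_retE H; rewrite mem_head.
inversion H as [| | |? ? ? ? H'|? ? ? ? H']; subst.
  by have [-> ->] := exec_retE H'; rewrite mem_head.
by have [xs ->] := IH _ H'; rewrite in_cons xs orbT.
Qed.

Lemma mem_maximizers (X : eqType) (s : seq (X * R)) x :
  x \in maximizers s ->
  exists2 v, (x, v) \in s & forall q, q \in s -> q.2 <= v.
Proof.
case/mapP=> -[y v]; rewrite mem_filter => /andP[/allP h yv] /= ->.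
by exists v.
Qed.

(** A nonempty finite list has an entry of largest value. Hence the loop can stop early only when no
    pair is admissible. *)
Lemma maximizers_nil (X : eqType) (s : seq (X * R)) :
  maximizers s = [::] -> s = [::].
Proof.
move=> h0.
have: ~ exists2 p, p \in s & forall q, q \in s -> q.2 <= p.2.
  case=> p ps /allP pmax.
  have: p.1 \in maximizers s by apply/map_f; rewrite mem_filter pmax.
  by rewrite h0.
case: s {h0} => // p s [].
elim: s p => [|p' s IH] p.
  by exists p; rewrite ?mem_head // => q /[!inE] /eqP ->.
have [q qs qmax] := IH p'; case: (leP p.2 q.2) => pq.
  exists q; first by rewrite in_cons qs orbT.
  by move=> z /[1!in_cons] /orP[/eqP -> //|]; apply: qmax.
exists p; first exact: mem_head.
move=> z /[1!in_cons] /orP[/eqP -> //|/qmax zq].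
exact: le_trans zq (ltW pq).
Qed.

Definition marginal (u : T) (S : {set T}) : R := f (u |: S) - f S.

Section Solutions.
Variable l : nat.
Implicit Types (S : 'I_l -> {set T}) (s : seq (T * 'I_l)).

(** Each pair costs one independence query and, if it passes, two value queries for its marginal. *)
Lemma exec_admissible S s A c : exec f I (admissible R S s) A c ->
  (c <= 3 * size s)%N /\
  A = [seq (p, marginal p.1 (S p.2)) | p <- s &
        (p.1 |: S p.2 \in I) && (0 < marginal p.1 (S p.2))].
Proof.
elim: s A c => [|[u j] s IH] A c /= H.
  by have [-> ->] := exec_retE H.
inversion H as [| |? ? ? c' H'| |]; subst.
case: ifP H' => _ H' /=; last first.
  have [le_c ->] := IH _ _ H'; split=> //.
  by lia.
inversion H' as [|? ? ? c1 H1| | |]; subst.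
inversion H1 as [|? ? ? c2 H2| | |]; subst.
have [B [d1 [d2 [/IH [le_d ->] Hd2 ->]]]] := exec_bindE H2.
have [-> ->] := exec_retE Hd2.
rewrite -/(marginal u (S j)); split; first by rewrite mulnS addn0 !add3n !ltnS.
by case: ifP.
Qed.

Lemma exec_ask_values S (s : seq 'I_l) V c : exec f I (ask_values R S s) V c ->
  c = size s /\ V = [seq (j, f (S j)) | j <- s].
Proof.
elim: s V c => [|j s IH] V c /= H; first by have [-> ->] := exec_retE H.
inversion H as [|? ? ? c' H'| | |]; subst.
have [B [d1 [d2 [/IH [-> ->] Hd2 ->]]]] := exec_bindE H'.
by have [-> ->] := exec_retE Hd2; rewrite addn0.
Qed.

(** The maximum ranges over all feasible pairs, including those of nonpositive gain that
    [admissible] discards: the chosen gain is positive and beats them anyway. *)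
Definition greedy_choice (N : {set T}) S (u : T) (j : 'I_l) :=
  [/\ u \in N, u |: S j \in I, 0 < marginal u (S j) &
      forall v i, v \in N -> v |: S i \in I ->
        marginal v (S i) <= marginal u (S j)].

Definition add_to S (u : T) (j : 'I_l) : 'I_l -> {set T} :=
  fun i => if i == j then u |: S i else S i.

Definition exhausted (N : {set T}) S :=
  forall v i, v \in N -> v |: S i \in I -> marginal v (S i) <= 0.

(** An invariant rule for the loop, with [t] counting iterations. Past iterations are added to [c]
    so that the induction composes; the extra one in [t'.+1] pays for the last scan, which finds
    nothing. *)
Lemma exec_greedy_loop (P : {set T} -> ('I_l -> {set T}) -> nat -> Prop) :
  (forall N S t u j, P N S t -> greedy_choice N S u j ->
     P (N :\ u) (add_to S u j) t.+1) ->
  forall m (N : {set T}) S S' c t, (#|N| <= m)%N -> P N S t ->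
  exec f I (greedy_loop R m N S) S' c ->
  exists N' t', [/\ P N' S' t', exhausted N' S' &
    (c + t * (3 * (#|T| * l)) <= t'.+1 * (3 * (#|T| * l)))%N].
Proof.
move=> Pstep; elim=> [|m IH] N S S' c t le_Nm PNS H.
  have [-> ->] := exec_retE H; exists N, t; split=> //.
    by move: le_Nm; rewrite leqn0 cards_eq0 => /eqP -> v i; rewrite inE.
  by rewrite leq_mul2r leqnSn orbT.
have [A [c1 [c2 [HA H2 ->]]]] := exec_bindE H.
have [le_c1 defA] := exec_admissible HA.
have {}le_c1 : (c1 <= 3 * (#|T| * l))%N.
  apply: leq_trans le_c1 _.
  rewrite size_allpairs -cardE size_enum_ord leq_mul2l leq_mul2r.
  by rewrite max_card orbT.
have memA v i : v \in N -> v |: S i \in I -> 0 < marginal v (S i) ->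
    ((v, i), marginal v (S i)) \in A.
  move=> vN vI v0; rewrite defA; apply/mapP; exists (v, i) => //.
  rewrite mem_filter /= vI v0 /=; apply/allpairsP; exists (v, i).
  by rewrite !mem_enum.
case defM: (maximizers A) H2 => [|y s] H2.
  have [-> ->] := exec_retE H2; exists N, t; split=> //.
    move=> v i vN vI; rewrite leNgt; apply/negP => /(memA v i vN vI).
    by rewrite (maximizers_nil defM).
  by rewrite addn0 mulSn leq_add2r.
have [[u j] [d1 [d2 [Hp Hl ->]]]] := exec_bindE H2.
have [uj_in ->] := exec_pick_any Hp.
have ch : greedy_choice N S u j.
  move: uj_in; rewrite -defM => /mem_maximizers[v uvA vmax].
  move: uvA; rewrite {1}defA => /mapP[[u' j']].
  rewrite mem_filter /= => /andP[/andP[uI u0] /allpairsP[[a b] /= [aN _]]].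
  case=> ? ? []; subst => ? ? ?; subst.
  rewrite mem_enum in aN; split=> // w i wN wI.
  case: (ltP 0 (marginal w (S i))) => w0; last exact: le_trans w0 (ltW u0).
  exact: (vmax _ (memA w i wN wI w0)).
have le_N' : (#|N :\ u| <= m)%N.
  by case: ch => uN _ _ _; move: le_Nm; rewrite (cardsD1 u N) uN.
have [N' [t' [P' ex' le_c]]] := IH _ _ _ _ _ le_N' (Pstep _ _ _ _ _ PNS ch) Hl.
exists N', t'; split=> //; apply: leq_trans le_c.
by rewrite mulSn; lia.
Qed.

Lemma exec_simultaneous_greedys
    (P : {set T} -> ('I_l -> {set T}) -> nat -> Prop) :
  (0 < l)%N ->
  P [set: T] (fun=> set0) 0%N ->
  (forall N S t u j, P N S t -> greedy_choice N S u j ->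
     P (N :\ u) (add_to S u j) t.+1) ->
  forall X c, exec f I (simultaneous_greedys T R l) X c ->
  exists N S t j, [/\ P N S t, exhausted N S, X = S j,
    forall i, f (S i) <= f X & (c <= t.+1 * (3 * (#|T| * l)) + l)%N].
Proof.
move=> l_gt0 P0 Pstep X c H.
have [S [c1 [c2 [HS H2 ->]]]] := exec_bindE H.
have le_T : (#|[set: T]| <= #|T|)%N by rewrite cardsT.
have [N [t [PNS ex le_c]]] := exec_greedy_loop Pstep le_T P0 HS.
have [V [d1 [d2 [/exec_ask_values [-> defV] H3 ->]]]] := exec_bindE H2.
have memV i : (i, f (S i)) \in V.
  by rewrite defV; apply: map_f; rewrite mem_enum.
case defM: (maximizers V) H3 => [|y s] H3.
  by have := memV (Ordinal l_gt0); rewrite (maximizers_nil defM).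
have [j [e1 [e2 [Hp Hr ->]]]] := exec_bindE H3.
have [j_in ->] := exec_pick_any Hp.
have [-> ->] := exec_retE Hr.
move: j_in; rewrite -defM => /mem_maximizers[v jvV vmax].
exists N, S, t, j; split=> //.
  move=> i; move: jvV; rewrite defV => /mapP[j' _ [-> vj]]; rewrite -vj.
  exact: (vmax _ (memV i)).
by rewrite size_enum_ord !addn0 leq_add2r; rewrite mul0n addn0 in le_c.
Qed.

End Solutions.
End OracleComputations.

(** * Marginals and unions under submodularity *)

Section SubmodularFunctions.
Variables (R : realType) (T : finType) (f : {set T} -> R).
Hypothesis f_sub : submodular f.
Implicit Types (A B S : {set T}) (u v : T).

(** Submodularity for [u |: A] and [B], which meet in [A]. If [u] were in [B], its marginal there
    would be 0 and could exceed a negative one at [A]. *)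
Lemma marginal_antitone u A B : A \subset B -> u \notin B ->
  marginal f u B <= marginal f u A.
Proof.
move=> sAB uB; have := f_sub (u |: A) B.
have -> : (u |: A) :|: B = u |: B by rewrite -setUA (setUidPr sAB).
have -> : (u |: A) :&: B = A.
  rewrite setIUl (setIidPl sAB); apply/setUidPr/subsetP => x.
  by rewrite !inE => /andP[/eqP ->]; rewrite (negPf uB).
by rewrite /marginal; lra.
Qed.

(** Truncation at 0 makes marginals antitone even when [u] lies in the larger set, and makes their
    sums grow with the index set. *)
Definition pos_marginal u S : R := Num.max 0 (marginal f u S).

Lemma pos_marginal_ge0 u S : 0 <= pos_marginal u S.
Proof. by rewrite le_max lexx. Qed.

Lemma pos_marginal_mem u S : u \in S -> pos_marginal u S = 0.
Proof.
move=> uS; rewrite /pos_marginal /marginal (setUidPr _) ?sub1set //.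
by rewrite subrr maxxx.
Qed.

Lemma pos_marginal_antitone u A B : A \subset B ->
  pos_marginal u B <= pos_marginal u A.
Proof.
move=> sAB; case: (boolP (u \in B)) => uB.
  by rewrite pos_marginal_mem ?pos_marginal_ge0.
by rewrite ge_max pos_marginal_ge0 /= le_max marginal_antitone ?orbT.
Qed.

Lemma sum_pos_marginal_antitone (X : {set T}) A B : A \subset B ->
  \sum_(u in X) pos_marginal u B <= \sum_(u in X) pos_marginal u A.
Proof. by move=> sAB; apply: ler_sum => u _; apply: pos_marginal_antitone. Qed.

Lemma sum_pos_marginal_setU S A B :
  \sum_(u in A :|: B) pos_marginal u S <=
  \sum_(u in A) pos_marginal u S + \sum_(u in B) pos_marginal u S.
Proof.
rewrite (bigID (mem A)) /=; apply: lerD.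
  rewrite (eq_bigl (mem A)) // => u; rewrite !inE.
  by case: (u \in A); rewrite ?andbF.
rewrite [leRHS](bigID (mem A)) /=; apply: ler_wpDl.
  by apply: sumr_ge0 => u _; apply: pos_marginal_ge0.
rewrite (eq_bigl (fun u => (u \in B) && (u \notin A))) // => u; rewrite !inE.
by case: (u \in A); rewrite ?andbF.
Qed.

Lemma sum_pos_marginal_subset S A B : A \subset B ->
  \sum_(u in A) pos_marginal u S <= \sum_(u in B) pos_marginal u S.
Proof.
move=> sAB; rewrite [leRHS](bigID (mem A)) /=.
rewrite [X in _ <= X + _](eq_bigl (mem A)) => [|u].
  by rewrite lerDl; apply: sumr_ge0 => u _; apply: pos_marginal_ge0.
by apply/andb_idl; apply: (subsetP sAB).
Qed.

Lemma le_sum_pos_marginal S A :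
  f (A :|: S) <= f S + \sum_(u in A) pos_marginal u S.
Proof.
have [n] := ubnP #|A|; elim: n A => // n IH A.
have [->|[u uA]] := set_0Vmem A; first by rewrite set0U big_set0 addr0.
rewrite -{2}(setD1K uA) (cardsD1 u) uA ltnS -setUA (big_setD1 u uA) /=.
move: (A :\ u) => {uA}A /IH{}IH.
have := pos_marginal_antitone u (subsetUr A S).
have : f (u |: (A :|: S)) - f (A :|: S) <= pos_marginal u (A :|: S).
  by rewrite le_max lexx orbT.
by move: IH; lra.
Qed.

(** The induction keeps the value of [O] united with all the [S j] on the smaller side. By
    disjointness, [O :|: S j] meets the union of [O] with the remaining sets exactly in [O], so each
    use of submodularity releases one [f O]. Nonnegativity drops the kept value at the end. *)
Lemma sum_union_disjoint_ge (J : finType) (S : J -> {set T}) (O : {set T})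
    (s : seq J) : nonnegative f ->
  uniq s -> (forall i j, i != j -> [disjoint S i & S j]) ->
  ((size s)%:R - 1) * f O <= \sum_(j <- s) f (O :|: S j).
Proof.
move=> f_ge0 s_uniq disj.
suff: (size s)%:R * f O + f (O :|: \bigcup_(j <- s) S j) <=
      \sum_(j <- s) f (O :|: S j) + f O.
  by have := f_ge0 (O :|: \bigcup_(j <- s) S j); lra.
elim: s s_uniq => [|j s IH] /=; first by rewrite !big_nil setU0; lra.
case/andP=> js /IH{}IH; rewrite !big_cons.
have := f_sub (O :|: S j) (O :|: \bigcup_(i <- s) S i).
rewrite -setUIr setUACA setUid.
have -> : S j :&: \bigcup_(i <- s) S i = set0.
  apply/eqP; rewrite setI_eq0 bigcup_seq.
  apply/bigcup_disjointP => i is_; apply: disj.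
  by apply: contraNneq js => ->.
rewrite setU0 -natr1; lra.
Qed.

End SubmodularFunctions.

(** * The charging argument in a k-system *)

Section Analysis.
Variables (R : realType) (T : finType) (I : {set {set T}}) (k : R).
Variables (f : {set T} -> R) (l : nat).
Hypotheses (kI : k_system k I) (f_sub : submodular f).
Implicit Types (N O : {set T}) (S : 'I_l -> {set T}).

Lemma indep_subset (A B : {set T}) : A \subset B -> B \in I -> A \in I.
Proof. by case: kI => -[_ sI] _; apply: sI. Qed.

(** Compare two bases of [A :|: B]: [A] itself, which no element of [B] can extend, and any maximal
    extension of [B]. *)
Lemma card_blocked (A B : {set T}) : A \in I -> B \in I ->
  (forall v, v \in B -> v |: A \notin I) -> #|B|%:R <= k * #|A|%:R.
Proof.
move=> AI BI blk; case: kI => _ ratio.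
have [X Xmax sBX] := @maxset_exists _
  (fun Y : {set T} => (Y \in I) && (Y \subset A :|: B)) B
  (introT andP (conj BI (subsetUr A B))).
have baseA : base I (A :|: B) A.
  apply/maxsetP; split; first by rewrite AI subsetUl.
  move=> Y /andP[YI sY] sAY; apply/eqP; rewrite eqEsubset sAY andbT.
  apply/subsetP => v vY; have := subsetP sY v vY; rewrite inE => /orP[//|vB].
  case/negP: (blk v vB); apply: indep_subset YI.
  by rewrite subUset sub1set vY.
apply: le_trans (ratio _ _ _ Xmax baseA).
by rewrite ler_nat subset_leq_card.
Qed.

Lemma disjoint_setU1 u (A B : {set T}) :
  [disjoint u |: A & B] = (u \notin B) && [disjoint A & B].
Proof. by rewrite -disjointU1; apply: eq_disjoint => v; rewrite !inE. Qed.

(** Each iteration adds one element, so the total size equals the iteration count; bounding it by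
    the rank later bounds the oracle calls. *)
Definition feasible_state N S (t : nat) :=
  [/\ forall j, S j \in I, forall i j, i != j -> [disjoint S i & S j],
      forall j, [disjoint S j & N] & (\sum_j #|S j|)%N = t].

Lemma feasible_start : set0 \in I -> feasible_state setT (fun=> set0) 0.
Proof.
by move=> I0; split=> // [i j _|j|]; rewrite ?disjoints0 ?disjoint0s //
  ?big1 // => *; rewrite ?cards0 // -setI_eq0 set0I.
Qed.

Lemma choice_notin N S t u j i :
  feasible_state N S t -> greedy_choice f I N S u j -> u \notin S i.
Proof.
case=> _ _ dN _ [uN _ _ _]; apply: contraTN uN => uS.
by have := disjointFr (dN i) uS => ->.
Qed.

Lemma feasible_step N S t u j : feasible_state N S t ->
  greedy_choice f I N S u j -> feasible_state (N :\ u) (add_to S u j) t.+1.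
Proof.
move=> st ch; have uS i := choice_notin i st ch.
case: st ch => SI dS dN <- [uN uI _ _]; split.
- by move=> i; rewrite /add_to; case: eqP => // ->.
- move=> i i' ii'; rewrite /add_to.
  case: (eqVneq i j) => [ij|_]; case: (eqVneq i' j) => [i'j|_]; last exact: dS.
  + by rewrite ij i'j eqxx in ii'.
  + by rewrite disjoint_setU1 uS dS.
  + by rewrite disjoint_sym disjoint_setU1 uS dS // eq_sym.
- move=> i; rewrite /add_to.
  have d : [disjoint S i & N :\ u] by apply: disjointWr (dN i); apply: subsetDl.
  by case: eqP => // _; rewrite disjoint_setU1 d !inE eqxx.
- rewrite (bigD1 j) //= [in RHS](bigD1 j) //= /add_to eqxx cardsU1 uS.
  by congr (_ + _).+1%N; apply: eq_bigr => i /negPf ->.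
Qed.

(* B collects the elements of O that S j came to block while they were still *)
(* available, H those that went to another solution although S j could have  *)
(* taken them. The surplus (k |S j| - |B|) g is an online Abel summation: as *)
(* g only decreases and the surplus count is nonnegative, k times each gain  *)
(* of S j pays for the elements it blocks, now or later.                     *)
Definition charging O (g : R) N S (j : 'I_l) (B H : {set T}) :=
  [/\ B \subset O, forall v, v \in B -> v |: S j \notin I,
      forall v, v \in O ->
        [|| v \in S j, v \in B, v \in H | (v \in N) && (v |: S j \in I)],
      \sum_(v in B) pos_marginal f v (S j) + (k * #|S j|%:R - #|B|%:R) * g
        <= k * (f (S j) - f set0)
    & \sum_(v in H) pos_marginal f v (S j)
        <= \sum_(i | i != j) (f (S i) - f set0)].

(** One threshold [g], shared by all solutions, bounds every gain still available; each iteration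
    lowers it to the gain just realized. *)
Definition charged_state O N S (t : nat) :=
  feasible_state N S t /\
  exists g, [/\ 0 <= g,
    forall v i, v \in N -> v |: S i \in I -> pos_marginal f v (S i) <= g
  & forall j, exists B H, charging O g N S j B H].

Lemma charged_start O : (forall u : T, [set u] \in I) -> set0 \in I ->
  charged_state O setT (fun=> set0) 0.
Proof.
move=> I1 I0; split; first exact: feasible_start.
(* Any upper bound on the initial gains would do, since the surplus count starts at 0. *)
exists (\sum_v pos_marginal f v set0); split=> [|v i _ _|j].
  by apply: sumr_ge0 => v _; apply: pos_marginal_ge0.
  rewrite (bigD1 v) //= lerDl; apply: sumr_ge0 => w _.
  exact: pos_marginal_ge0.
exists set0, set0; split=> [|v|v _||]; rewrite ?sub0set ?inE //=.
- by rewrite setU0 I1.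
- by rewrite big_set0 cards0 mulr0 !subrr mul0r mulr0 addr0.
- by rewrite big_set0 big1 // => i _; rewrite subrr.
Qed.

Section Step.
Variables (O N : {set T}) (S : 'I_l -> {set T}) (t : nat) (g : R).
Variables (u : T) (j : 'I_l).
Hypotheses (OI : O \in I) (st : feasible_state N S t).
Hypothesis ch : greedy_choice f I N S u j.
Hypothesis g_max : forall v i, v \in N -> v |: S i \in I ->
  pos_marginal f v (S i) <= g.

Local Notation d := (marginal f u (S j)).

Lemma pos_marginal_choice v i : v \in N -> v |: S i \in I ->
  pos_marginal f v (S i) <= d.
Proof.
by case: ch => _ _ /ltW d0 dmax vN vI; rewrite ge_max d0 dmax.
Qed.

Lemma choice_le : d <= g.
Proof.
case: ch => uN uI _ _; apply: le_trans (g_max uN uI).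
by rewrite le_max lexx orbT.
Qed.

(** The new members of [B] are the available elements of [O] that [u] blocks, each of gain at most
    [d]. Their marginals are paid by the drop [#|B'| * d] of the surplus, while [k * d] enters both
    sides. *)
Lemma charging_step_same B H : charging O g N S j B H ->
  charging O d (N :\ u) (add_to S u j) j
    (B :|: [set v in O | [&& v \in N, v != u, v |: S j \in I &
                           v |: (u |: S j) \notin I]]) H.
Proof.
case=> sBO blk cov sumB sumH; set B' := finset _.
have uS := choice_notin j st ch.
have SI : S j \in I by case: st.
have sSS : S j \subset u |: S j := subsetUr _ _.
have addE : add_to S u j j = u |: S j by rewrite /add_to eqxx.
have dBB' : [disjoint B & B'].
  apply/pred0P => v /=; apply/negP => /andP[vB]; rewrite inE.
  by case/and5P => _ _ _ vI _; rewrite (negPf (blk v vB)) in vI.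
split; rewrite ?addE.
- rewrite subUset sBO; apply/subsetP => v; rewrite inE.
  by case/andP.
- move=> v; rewrite !inE => /orP[/blk|/and5P[]//].
  by apply: contra; apply: indep_subset; apply: setUS.
- move=> v vO; have := cov v vO; rewrite !inE vO /=.
  case/or4P => [->|->|->|/andP[-> ->]]; rewrite ?orbT //=.
  by case: (v == u) => //=; case: (_ \in I); rewrite ?orbT.
- have cB : #|B|%:R <= k * #|S j|%:R.
    by apply: card_blocked => //; apply: indep_subset sBO OI.
  rewrite (cardsU1 u) uS natrD.
  have -> : #|B :|: B'|%:R = #|B|%:R + #|B'|%:R :> R.
    by rewrite -natrD cardsU disjoint_setI0 // cards0 subn0.
  have := sum_pos_marginal_setU f (u |: S j) B B'.
  have := sum_pos_marginal_antitone f_sub B sSS.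
  have := sum_pos_marginal_antitone f_sub B' sSS.
  have : \sum_(v in B') pos_marginal f v (S j) <= #|B'|%:R * d.
    rewrite mulr_natl -sumr_const; apply: ler_sum => v; rewrite inE.
    by case/and5P => _ vN _ vI _; apply: pos_marginal_choice.
  (* The old surplus count is nonnegative by [card_blocked], so lowering [g] to [d] is harmless. *)
  have : (k * #|S j|%:R - #|B|%:R) * d <= (k * #|S j|%:R - #|B|%:R) * g.
    by apply: ler_wpM2l choice_le; rewrite subr_ge0.
  have -> : f (u |: S j) = f (S j) + d by rewrite /marginal; ring.
  move: sumB; rewrite /=; lra.
- apply: le_trans (sum_pos_marginal_antitone f_sub H sSS) _.
  apply: le_trans sumH _; rewrite le_eqVlt; apply/orP; left; apply/eqP.
  by apply: eq_bigr => i /negPf ij; rewrite /add_to ij.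
Qed.

(** If [S i] could have taken [u], its gain there is at most [d], which is exactly what [f (S j)]
    adds to the bound for [H]. *)
Lemma charging_step_other i B H : i != j -> charging O g N S i B H ->
  charging O d (N :\ u) (add_to S u j) i B
    (if u |: S i \in I then u |: H else H).
Proof.
move=> ij [sBO blk cov sumB sumH].
have addE : add_to S u j i = S i by rewrite /add_to (negPf ij).
split; rewrite ?addE //.
- move=> v vO; case/or4P: (cov v vO) => [->|->|vH|/andP[vN vI]];
    rewrite ?orbT //.
    by apply/or4P/Or43; case: ifP => // _; rewrite !inE vH orbT.
  rewrite !inE vN vI; case: eqVneq => [vu|_]; last by rewrite !orbT.
  by rewrite -vu vI !inE eqxx !orbT.
- apply: le_trans sumB; rewrite lerD2l; apply: ler_wpM2l choice_le.
  rewrite subr_ge0; apply: card_blocked => //; first by case: st.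
  exact: indep_subset sBO OI.
- have -> : \sum_(i0 | i0 != i) (f (add_to S u j i0) - f set0) =
            \sum_(i0 | i0 != i) (f (S i0) - f set0) + d.
    rewrite (bigD1 j) 1?eq_sym //= [in RHS](bigD1 j) 1?eq_sym //=.
    rewrite {1}/add_to eqxx.
    under eq_bigr => i0 /andP[_ /negPf ij0] do rewrite /add_to ij0.
    by rewrite /marginal; ring.
  have d0 : 0 < d by case: ch.
  case: ifP => uI; last by move: sumH; lra.
  have := sum_pos_marginal_setU f (S i) [set u] H; rewrite big_set1.
  have := @pos_marginal_choice u i; case: ch => uN _ _ _ /(_ uN uI).
  move: sumH; lra.
Qed.

End Step.

Lemma charged_step O N S t u j : O \in I -> charged_state O N S t ->
  greedy_choice f I N S u j -> charged_state O (N :\ u) (add_to S u j) t.+1.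
Proof.
move=> OI [st [g [_ g_max chg]]] ch; split; first exact: feasible_step.
have SS' i : S i \subset add_to S u j i.
  by rewrite /add_to; case: ifP; rewrite ?subsetUr.
exists (marginal f u (S j)); split=> [|v i|i].
  by case: ch => _ _ /ltW.
  rewrite !inE => /andP[_ vN] vI.
  apply: le_trans (pos_marginal_antitone f_sub v (SS' i)) _.
  apply: (pos_marginal_choice ch vN).
  by apply: indep_subset vI; apply: setUS.
have [B [H BH]] := chg i; have [ij|ij] := eqVneq i j; last first.
  by exists B; eexists; exact: (charging_step_other OI st ch g_max ij BH).
subst i; eexists; exists H; exact: (charging_step_same OI st ch g_max BH).
Qed.

(** At the end, elements of [O] outside [B] and [H] lie in [S j] or are available without gain, so
    only [B] and [H] count. They cost at most [k * M] and [(l - 1) * M], and [f (S j)] adds one more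
    [M]. *)
Lemma charged_final O N S t (j : 'I_l) M : O \in I ->
  0 <= k -> nonnegative f ->
  charged_state O N S t -> exhausted f I N S -> (forall i, f (S i) <= M) ->
  f (O :|: S j) <= (k + l%:R) * M.
Proof.
move=> OI k0 f_ge0 [st [g [g0 _ /(_ j)[B [H [sBO blk cov sumB sumH]]]]]] ex leM.
have zero v : v \in O -> v \notin B :|: H -> pos_marginal f v (S j) = 0.
  move=> vO; rewrite inE negb_or => /andP[vB vH]; have := cov v vO.
  rewrite (negPf vB) (negPf vH) /=.
  case/orP=> [/pos_marginal_mem -> //|/andP[vN vI]].
  by apply/max_idPl; apply: ex.
have sumO : \sum_(v in O) pos_marginal f v (S j) <=
            \sum_(v in B :|: H) pos_marginal f v (S j).
  rewrite (big_setID (B :|: H)) /= [X in _ + X]big1 => [|v]; last first.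
    by rewrite inE => /andP[? ?]; apply: zero.
  by rewrite addr0; apply: sum_pos_marginal_subset; apply: subsetIr.
have := le_sum_pos_marginal f_sub (S j) O.
have := sum_pos_marginal_setU f (S j) B H.
have surplus : 0 <= (k * #|S j|%:R - #|B|%:R) * g.
  apply: mulr_ge0 => //; rewrite subr_ge0; apply: card_blocked => //.
    by case: st.
  exact: indep_subset sBO OI.
have le_sumH : \sum_(i | i != j) (f (S i) - f set0) <= (l%:R - 1) * M.
  have -> : (l%:R - 1) * M = \sum_(i < l | i != j) M.
    have l_gt0 : (0 < l)%N := leq_ltn_trans (leq0n j) (ltn_ord j).
    rewrite sumr_const cardC1 card_ord -[RHS]mulr_natl; congr (_ * _).
    by rewrite -{1}(prednK l_gt0) -natr1 addrK.
  by apply: ler_sum => i _; have := f_ge0 set0; have := leM i; lra.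
have : k * (f (S j) - f set0) <= k * M.
  by apply: ler_wpM2l => //; have := f_ge0 set0; have := leM j; lra.
have := leM j; move: sumB sumH sumO; lra.
Qed.

End Analysis.

(** * Call bound and approximation inequalities for general [l] *)

Section Guarantee.
Variables (R : realType) (T : finType) (I : {set {set T}}) (k : R).
Variables (f : {set T} -> R) (l : nat).
Hypotheses (k_ge1 : 1 <= k) (kI : k_system k I).
Hypothesis I1 : forall u : T, [set u] \in I.
Hypotheses (f_ge0 : nonnegative f) (f_sub : submodular f) (l_gt0 : (0 < l)%N).

Lemma indep0 : set0 \in I.
Proof.
case: (kI) => -[/set0Pn[X XI] _] _.
exact: (indep_subset kI (sub0set X) XI).
Qed.

Lemma simultaneous_greedys_indep_calls X c :
  exec f I (simultaneous_greedys T R l) X c ->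
  X \in I /\
  ((0 < #|T|)%N -> (c <= 7 * ((l * l) * rank I * #|T|))%N).
Proof.
clear k_ge1; move=> H.
have [N [S [t [j [[SI _ _ <-] _ -> _ le_c]]]]] :=
  exec_simultaneous_greedys l_gt0 (feasible_start l indep0)
    (@feasible_step R T I f l) H.
split=> // T_gt0.
have le_rank (A : {set T}) : A \in I -> (#|A| <= rank I)%N.
  by move=> AI; apply: leq_bigmax_cond.
have r_gt0 : (0 < rank I)%N.
  case/card_gt0P: T_gt0 => u _.
  by rewrite (leq_trans _ (le_rank _ (I1 u))) // cards1.
have le_t : (\sum_i #|S i| <= l * rank I)%N.
  rewrite -[X in (X * _)%N](card_ord l) -sum_nat_const.
  by apply: leq_sum => i _; apply: le_rank.
apply: leq_trans le_c _; move: (\sum_i _)%N le_t => t' le_t.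
have lr_gt0 : (0 < l * rank I)%N by rewrite muln_gt0 l_gt0.
(* The final scan is absorbed because [l * rank I] is at least 1. The constant is 7 = 2 * 3 + 1, the
   1 paying for the [l] closing value queries. *)
have le_t1 : (t'.+1 <= 2 * (l * rank I))%N by lia.
have := leq_mul le_t1 (leqnn (3 * (#|T| * l))).
have : (l <= l * (l * rank I * #|T|))%N
  by rewrite leq_pmulr ?muln_gt0 ?l_gt0 ?r_gt0.
by nia.
Qed.

Lemma simultaneous_greedys_union O X c : O \in I ->
  exec f I (simultaneous_greedys T R l) X c ->
  exists S : 'I_l -> {set T},
    [/\ forall i j, i != j -> [disjoint S i & S j]
      & forall j, f (O :|: S j) <= (k + l%:R) * f X].
Proof.
move=> OI H.
have [N [S [t [j [chg ex _ Smax _]]]]] :=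
  exec_simultaneous_greedys l_gt0 (charged_start k f l O I1 indep0)
    (fun N S t u j => @charged_step _ _ _ _ _ _ kI f_sub O N S t u j OI) H.
exists S; split=> [|i]; first by case: chg => -[].
by apply: charged_final chg ex Smax => //; apply: le_trans k_ge1.
Qed.

Lemma simultaneous_greedys_ratio O X c : O \in I ->
  exec f I (simultaneous_greedys T R l) X c ->
  (l%:R - 1) * f O <= l%:R * (k + l%:R) * f X.
Proof.
move=> OI /(simultaneous_greedys_union OI) [S [dS leS]].
have := sum_union_disjoint_ge f_sub O f_ge0 (enum_uniq 'I_l) dS.
rewrite size_enum_ord => /le_trans; apply.
rewrite big_enum /= -mulrA -[X in X%:R * (_ * _)](card_ord l) mulr_natl.
rewrite -sumr_const; exact: ler_sum.
Qed.

Lemma simultaneous_greedys_monotone_ratio O X c : monotone f -> O \in I ->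
  exec f I (simultaneous_greedys T R l) X c -> f O <= (k + l%:R) * f X.
Proof.
move=> f_mono OI /(simultaneous_greedys_union OI) [S [_ leS]].
by apply: le_trans (leS (Ordinal l_gt0)); apply: f_mono; apply: subsetUl.
Qed.

End Guarantee.

(** * Numerical estimates for the chosen number of solutions *)

Section Constants.
Variable R : realType.

Lemma num_solutions_bounds (k : R) (l := Num.truncn (2 + Num.sqrt (k + 2))) :
  1 + Num.sqrt (k + 2) < l%:R <= 2 + Num.sqrt (k + 2).
Proof.
have s0 : 0 <= Num.sqrt (k + 2) :> R := sqrtr_ge0 _.
have : 0 <= 2 + Num.sqrt (k + 2) by lra.
by move=> /truncn_itv; rewrite -/l -natr1 => /andP[-> ?]; rewrite andbT; lra.
Qed.

Lemma num_solutions_ratio (k x y : R) (l := Num.truncn (2 + Num.sqrt (k + 2))) :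
  1 <= k -> 0 <= y -> (l%:R - 1) * x <= l%:R * (k + l%:R) * y ->
  x <= (1 + Num.sqrt (k + 2)) ^+ 2 * y.
Proof.
move=> k1 y0 le_xy; have /andP[] := num_solutions_bounds k; rewrite -/l.
set s : R := Num.sqrt (k + 2); move: (l%:R : R) le_xy => z le_xy lo hi.
have s0 : 0 <= s := sqrtr_ge0 _.
have sk : s ^+ 2 = k + 2 by rewrite sqr_sqrtr //; lra.
have z1 : 0 < z - 1 by lra.
rewrite -(ler_pM2l z1); apply: le_trans le_xy _.
rewrite mulrA; apply: ler_wpM2r => //.
have -> : k = s ^+ 2 - 2 by lra.
(* The right-hand side exceeds the left by (z - 1 - s) (2 + s - z) + (1 + s). *)
have : 0 <= (z - 1 - s) * (2 + s - z) by apply: mulr_ge0; lra.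
nra.
Qed.

Lemma num_solutions_sqr (k : R) (l := Num.truncn (2 + Num.sqrt (k + 2))) :
  1 <= k -> l%:R * l%:R <= 14 * k.
Proof.
move=> k1; have /andP[_] := num_solutions_bounds k; rewrite -/l.
set s : R := Num.sqrt (k + 2); move=> hi.
have sk : s ^+ 2 = k + 2 by rewrite sqr_sqrtr //; lra.
apply: (@le_trans _ _ ((2 + s) * (2 + s))); first exact: ler_pM.
(* From [4 * s <= s ^+ 2 + 4] the square is at most [2 * k + 12], hence at most [14 * k] for
   [k >= 1]. *)
by have := sqr_ge0 (s - 2); lra.
Qed.

Lemma ratio_asymptotics (k : R) : 1 <= k ->
  `|(1 + Num.sqrt (k + 2)) ^+ 2 - k| <= 7 * Num.sqrt k.
Proof.
move=> k1.
have sk : Num.sqrt (k + 2) ^+ 2 = k + 2 by rewrite sqr_sqrtr //; lra.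
have tk : Num.sqrt k ^+ 2 = k by rewrite sqr_sqrtr //; lra.
have : 0 <= Num.sqrt (k + 2) :> R := sqrtr_ge0 _.
have : 1 <= Num.sqrt k by rewrite -[leLHS]sqrtr1 ler_wsqrtr.
move: (Num.sqrt k) (Num.sqrt (k + 2)) sk tk => t s sk tk t1 s0.
rewrite ger0_norm sqrrD sk; last by lra.
(* The difference equals [3 + 2 * s]; with [s <= 2 * t] and [1 <= t] it is at most [7 * t]. *)
have : s <= 2 * t by rewrite -(@ler_pXn2r _ 2) ?nnegrE ?exprMn ?sk ?tk //; lra.
lra.
Qed.

End Constants.

Theorem theorem3 (R : realType) :
  (exists C : R, forall (T : finType) (I : {set {set T}}) (k : R)
      (f : {set T} -> R),
    1 <= k -> k_system k I -> (forall u : T, [set u] \in I) ->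
    nonnegative f -> submodular f ->
    (forall (S : {set T}) (c : nat),
      exec f I (simultaneous_greedys T R (Num.truncn (2 + Num.sqrt (k + 2)))) S c ->
      [/\ S \in I,
          approx_ratio_le f I ((1 + Num.sqrt (k + 2)) ^+ 2) S
        & (0 < #|T|)%N -> c%:R <= C * (k * (rank I)%:R * #|T|%:R)]) /\
    (monotone f -> forall (S : {set T}) (c : nat),
      exec f I (simultaneous_greedys T R 1%N) S c ->
      [/\ S \in I,
          approx_ratio_le f I (k + 1) S
        & (0 < #|T|)%N -> c%:R <= C * (k * (rank I)%:R * #|T|%:R)])) /\
  (exists C : R, forall k : R, 1 <= k ->
    `|(1 + Num.sqrt (k + 2)) ^+ 2 - k| <= C * Num.sqrt k).
Proof.
split; last by exists 7 => k; apply: ratio_asymptotics.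
(* 98 = 7 * 14: the call bound has constant 7 and [l ^ 2] is at most [14 * k]. *)
exists 98 => T I k f k1 kI I1 f0 f_sub; split=> [X c|f_mono X c] H.
- have /andP[lo _] := num_solutions_bounds k.
  have s0 : 0 <= Num.sqrt (k + 2) :> R := sqrtr_ge0 _.
  move: lo; set l := Num.truncn _ in H * => lo.
  have l_gt0 : (0 < l)%N by rewrite -(ltr_nat R); lra.
  have [XI calls] := simultaneous_greedys_indep_calls kI I1 l_gt0 H.
  split=> // [O [OI _]|/calls le_c].
    have ratio_gt0 : 0 < (1 + Num.sqrt (k + 2)) ^+ 2 by apply: exprn_gt0; lra.
    rewrite ler_pdivrMr // mulrC; apply: (num_solutions_ratio k1 (f0 X)).
    exact: (simultaneous_greedys_ratio k1 kI I1 f0 f_sub l_gt0 OI H).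
  move: le_c; rewrite -(ler_nat R) => /le_trans; apply; rewrite !natrM.
  have rT : 0 <= (rank I)%:R * #|T|%:R :> R by apply: mulr_ge0.
  by have := ler_wpM2r rT (num_solutions_sqr k1); rewrite -/l; lra.
- have [XI calls] := simultaneous_greedys_indep_calls kI I1 (ltnSn 0) H.
  split=> // [O [OI _]|/calls le_c].
    have ratio_gt0 : 0 < k + 1 by lra.
    rewrite ler_pdivrMr // mulrC.
    exact: (simultaneous_greedys_monotone_ratio k1 kI I1 f0 f_sub (ltnSn 0)
              f_mono OI H).
  move: le_c; rewrite -(ler_nat R) => /le_trans; apply; rewrite !natrM.
  have rT : 0 <= (rank I)%:R * #|T|%:R :> R by apply: mulr_ge0.
  by have := ler_wpM2r rT k1; lra.
Qed.
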